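(* There exists a normally rising orientation reversing homeomorphism $f:J^2\rightarrow J^2$ such that $\omega(x,f)=\{v_1,v_2\}$ and $\alpha(x,f)=\{v_3,v_4\}$ for every $x\in(-1,1)^2$, and $f|_{\partial J^2}=(\Psi\circ f_{02})|_{\partial J^2}$.
   Context: Let $J=[-1,1]$, so that $J^2=[-1,1]^2$ has boundary $\partial J^2=(\{-1,1\}\times J)\cup(J\times\{-1,1\})$ and interior $(-1,1)^2$. Its vertices are written $v_1=(-1,1)$, $v_2=(1,1)$, $v_3=(-1,-1)$, $v_4=(1,-1)$. Define the homeomorphism $f_{01}:J\to J$ by $f_{01}(s)=(s+1)/2$ for $0\le s\le 1$, $f_{01}(s)=s+1/2$ for $-1/2\le s\le 0$, and $f_{01}(s)=2s+1$ for $-1\le s\le -1/2$. The standard vertical shift $f_{02}:J^2\to J^2$ is $f_{02}(r,s)=(r,f_{01}(s))$. The level reflection $\Psi:J^2\to J^2$ is $\Psi(r,s)=(-r,s)$. For $s\in J$ write $J_s=J\times\{s\}$. A homeomorphism $\zeta:J^2\to J^2$ is called normally rising if $\zeta(J_s)=f_{02}(J_s)$ for every $s\in J$. For a homeomorphism $f$ of a metric space $X$ and $x\in X$, $\omega(x,f)$ is the set of all $y\in X$ for which there is a sequence of positive integers $n_1<n_2<\cdots$ with $f^{n_i}(x)\to y$, and $\alpha(x,f)=\omega(x,f^{-1})$. *)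

(* Defs.v *)
From HB Require Import structures.
From mathcomp Require Import all_boot all_order all_algebra.
From mathcomp Require Import all_classical all_reals all_analysis.
From mathcomp Require Import lra.

Set Implicit Arguments.
Unset Strict Implicit.
Unset Printing Implicit Defensive.

Import Order.TTheory GRing.Theory Num.Theory numFieldNormedType.Exports.
Local Open Scope classical_set_scope.
Local Open Scope ring_scope.

Record homeomorphism (X Y : topologicalType) := Homeomorphism {
  homeo_fun :> X -> Y;
  homeo_inv : Y -> X;
  homeo_funK : cancel homeo_fun homeo_inv;
  homeo_invK : cancel homeo_inv homeo_fun;
  homeo_fun_continuous : continuous homeo_fun;
  homeo_inv_continuous : continuous homeo_inv }.

Definition homeo_sym (X Y : topologicalType) (f : homeomorphism X Y) :
    homeomorphism Y X :=
  Homeomorphism (homeo_invK f) (homeo_funK f)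
    (@homeo_inv_continuous _ _ f) (@homeo_fun_continuous _ _ f).

Definition omega_limit (X : topologicalType) (f : homeomorphism X X) (x : X) :
    set X :=
  [set y | exists n : nat -> nat,
    [/\ forall i, (0 < n i)%N, forall i, (n i < n i.+1)%N &
        (fun i => iter (n i) f x) @ \oo --> y]].

Definition alpha_limit (X : topologicalType) (f : homeomorphism X X) (x : X) :
    set X :=
  omega_limit (homeo_sym f) x.

Definition J (R : realType) : set R := `[-1, 1].
Arguments J R : clear implicits.

Definition J2 (R : realType) : set (R * R) := J R `*` J R.
Arguments J2 R : clear implicits.

(* [J2] as a space of its own, with the topology induced from the plane *)
Definition square (R : realType) : topologicalType := set_type (J2 R).

Definition mk_square (R : realType) (r s : R) (rJ : J R r) (sJ : J R s) :
    square R :=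
  exist _ (r, s) (mem_set (conj rJ sJ : J2 R (r, s))).

Lemma square1P (R : realType) (p : square R) : J R (\val p).1.
Proof. by case: (set_mem (valP p)). Qed.

Lemma square2P (R : realType) (p : square R) : J R (\val p).2.
Proof. by case: (set_mem (valP p)). Qed.

Definition f01 (R : realType) (s : R) : R :=
  if 0 <= s then (s + 1) / 2
  else if - (1 / 2) <= s then s + 1 / 2
  else 2 * s + 1.

Lemma J_f01 (R : realType) (s : R) : J R s -> J R (f01 s).
Proof.
rewrite /J /f01 /= !in_itv /= => /andP[s1 s2].
by case: (leP 0 s) => ?; [|case: (leP (- (1 / 2)) s) => ?];
  apply/andP; split; lra.
Qed.

Lemma J_opp (R : realType) (r : R) : J R r -> J R (- r).
Proof.
rewrite /J /= !in_itv /= => /andP[r1 r2].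
by apply/andP; split; lra.
Qed.

Lemma J_m1 (R : realType) : J R (-1).
Proof. by rewrite /J /= in_itv /=; apply/andP; split; lra. Qed.

Lemma J_1 (R : realType) : J R 1.
Proof. by rewrite /J /= in_itv /=; apply/andP; split; lra. Qed.

Definition f02 (R : realType) (p : square R) : square R :=
  mk_square (square1P p) (J_f01 (square2P p)).

Definition Psi (R : realType) (p : square R) : square R :=
  mk_square (J_opp (square1P p)) (square2P p).

Definition v1 (R : realType) : square R := mk_square (J_m1 R) (J_1 R).
Definition v2 (R : realType) : square R := mk_square (J_1 R) (J_1 R).
Definition v3 (R : realType) : square R := mk_square (J_m1 R) (J_m1 R).
Definition v4 (R : realType) : square R := mk_square (J_1 R) (J_m1 R).

Definition interior_square (R : realType) : set (square R) :=
  [set p | (`]-1, 1[ `*` `]-1, 1[) (\val p)].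
Arguments interior_square R : clear implicits.

Definition boundary_square (R : realType) : set (square R) :=
  [set p | ([set -1; 1] `*` J R `|` J R `*` [set -1; 1]) (\val p)].
Arguments boundary_square R : clear implicits.

Definition level (R : realType) (s : R) : set (square R) :=
  [set p | (J R `*` [set s]) (\val p)].

Definition normally_rising (R : realType)
    (zeta : homeomorphism (square R) (square R)) : Prop :=
  forall s, J R s -> zeta @` level s = @f02 R @` level s.

(* The loop [gam], parametrized by [0, 1], winds [n] times around [c]: in polar
   coordinates (rho, theta) centered at [c] with a continuous choice of the
   angle, the total variation of the angle is 2 pi n. *)
Definition has_winding_number (R : realType) (gam : R -> R * R) (c : R * R)
    (n : int) : Prop :=
  exists rho theta : R -> R,
    [/\ {within `[0, 1], continuous theta},
        forall t, t \in `[0, 1] -> 0 < rho t /\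
          gam t = (c.1 + rho t * cos (theta t), c.2 + rho t * sin (theta t)) &
        theta 1 - theta 0 = 2 * pi * n%:~R].

(* [h] has local degree -1: it sends every counterclockwise circle contained in
   the square, of center [c] (necessarily an interior point), to a loop winding
   -1 times around [h c]. *)
Definition orientation_reversing (R : realType)
    (h : homeomorphism (square R) (square R)) : Prop :=
  forall (c : square R) (r : R) (gam : R -> square R), 0 < r ->
    (forall t, \val (gam t) =
       ((\val c).1 + r * cos (2 * pi * t), (\val c).2 + r * sin (2 * pi * t))) ->
    has_winding_number (fun t => \val (h (gam t))) (\val (h c)) (-1).

(* Main.v *)
(* On each level J_s the interval J is identified with the extended real line
   by x |-> th x, and f is sought in the form (x, s) |-> (G s - x, f01 s).
   Choosing G s = b s + b (f01 s) for a function b on (-1, 1), the shear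
   x |-> x - b s conjugates f to (x, s) |-> (-x, f01 s), so that the n-th
   iterate of (x, s) has first coordinate b (s_n) + (-1)^n (x - b s), with s_n
   the orbit of s under f01. It is thus enough that G s -> 0 as s -> 1 or -1,
   for f to extend continuously to the boundary, and that (-1)^n b (s_n) tends
   to +oo or to -oo for every s. In a coordinate t making f01 the translation
   by 1 near s = 1, this is achieved by b = a(t)^2 cos (pi t) + a(t) sin (pi t)
   with a(t) = t^(1/4): it grows, but so slowly that b(t) + b(t + 1) -> 0; the
   second term takes over exactly on the orbits where cos (pi t) = 0.
   Taking b even, and since - f01 (- s) is the inverse of f01, the reflection
   s |-> - s conjugates f to its inverse, which gives the alpha-limit sets. *)
Require Import Defs.
From mathcomp Require Import all_boot all_order all_algebra.
From mathcomp Require Import all_classical all_reals all_analysis.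
From mathcomp Require Import lra ring.

Set Implicit Arguments.
Unset Strict Implicit.
Unset Printing Implicit Defensive.

Import Order.TTheory GRing.Theory Num.Theory numFieldNormedType.Exports.
Local Open Scope classical_set_scope.
Local Open Scope ring_scope.

(** * The vertical shift *)

Section vertical_shift.
Variable R : realType.
Implicit Types s : R.

(** [f01] is concave, with slopes 2, 1, 1/2 from left to right, so it is the minimum of its affine
    pieces; its continuity then needs no gluing. *)
Lemma f01_minE s :
  f01 s = Num.min (Num.min ((s + 1) / 2) (s + 1 / 2)) (2 * s + 1).
Proof.
rewrite /f01 !minElt.
by case: (leP 0 s) => ?; [|case: (leP (- (1 / 2)) s) => ?];
  do 2 ?[case: ifPn => [|]]; rewrite -?leNgt; lra.
Qed.

Lemma f01_continuous : continuous (@f01 R).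
Proof.
move=> s.
rewrite (_ : @f01 R = (fun s => (s + 1) / 2) \min (fun s => s + 1 / 2) \min
    (fun s => 2 * s + 1)); last by apply/funext => x; exact: f01_minE.
apply: continuous_min; [apply: continuous_min|].
- by apply: cvgMl; apply: cvgD; [exact: cvg_id|exact: cvg_cst].
- by apply: cvgD; [exact: cvg_id|exact: cvg_cst].
- by apply: cvgD; [apply: cvgMr; exact: cvg_id|exact: cvg_cst].
Qed.

Lemma f01_lt s1 s2 : s1 < s2 -> f01 s1 < f01 s2.
Proof.
rewrite /f01.
case: (leP 0 s1) => ?; [|case: (leP (- (1 / 2)) s1) => ?];
  (case: (leP 0 s2) => ?; [|case: (leP (- (1 / 2)) s2) => ?]); lra.
Qed.

Lemma f01_le s1 s2 : s1 <= s2 -> f01 s1 <= f01 s2.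
Proof. by rewrite le_eqVlt => /predU1P[->//|/f01_lt/ltW]. Qed.

Lemma f01NK s : - f01 (- f01 s) = s.
Proof.
rewrite /f01.
case: (leP 0 s) => ?; [|case: (leP (- (1 / 2)) s) => ?];
  (case: leP => ?; [|case: leP => ?]); lra.
Qed.

Lemma f01_N1 : f01 (-1) = -1 :> R.
Proof. by rewrite /f01; case: leP => ?; [|case: leP => ?]; lra. Qed.

Lemma f01_norm_lt1 s : (`|f01 s| < 1) = (`|s| < 1).
Proof.
rewrite /f01 !ltr_norml.
by apply/idP/idP => /andP[]; case: (leP 0 s) => ?;
  [|case: (leP (- (1 / 2)) s) => ?| |case: (leP (- (1 / 2)) s) => ?] => ? ?;
  apply/andP; split; lra.
Qed.

Lemma f01_ge0 s : 0 <= s -> f01 s = (s + 1) / 2.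
Proof. by rewrite /f01 => ->. Qed.

Lemma iter_f01_norm_lt1 n s : `|s| < 1 -> `|iter n (@f01 R) s| < 1.
Proof. by move=> s1; elim: n => //= n; rewrite f01_norm_lt1. Qed.

Lemma iter_f01_ge0 n s : 0 <= s -> 1 - iter n (@f01 R) s = (1 - s) / 2 ^+ n.
Proof.
move=> s0; elim: n => [|n IHn]; first by rewrite expr0 divr1.
have sn0 : 0 <= iter n (@f01 R) s.
  elim: n {IHn} => //= n IHn; rewrite f01_ge0//; lra.
rewrite iterS f01_ge0// exprS invfM.
rewrite mulrCA -IHn; lra.
Qed.

(** While the orbit is negative, a step from x adds 1/2 or 1 + x, and 1 + x >= 1 + s because the
    orbit never drops below s: the gain per step is bounded below by a positive constant. *)
Lemma iter_f01_reaches_ge0 s : `|s| < 1 -> exists n, 0 <= iter n (@f01 R) s.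
Proof.
move=> s1; apply: contrapT => /forallNP neg.
have step n : s + Num.min (1 / 2) (1 + s) *+ n <= iter n (@f01 R) s /\
    s <= iter n (@f01 R) s.
  elim: n => [|n [IHn IHn']]; first by rewrite mulr0n addr0.
  move: s1 (neg n); rewrite ltr_norml => /andP[? ?] /negP.
  rewrite -ltNge mulrSr => sn0 /=.
  move: (iter n _ s) (_ *+ n) IHn IHn' sn0 => x y IHn IHn' x0.
  rewrite /f01 (lt_geF x0) minElt.
  by case: ifPn; rewrite -?leNgt => ?; case: (leP (- (1 / 2)) x) => ?;
    split; lra.
have d0 : 0 < Num.min (1 / 2) (1 + s).
  by move: s1; rewrite ltr_norml lt_min => /andP[? ?]; apply/andP; split; lra.
have [n sn] : exists n, - s < Num.min (1 / 2) (1 + s) *+ n.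
  move: (Num.min _ _) d0 => d d0; exists (Num.bound `|- s / d|).
  rewrite -mulr_natl -ltr_pdivrMr//.
  by apply: le_lt_trans (archi_boundP _); [exact: ler_norm|exact: normr_ge0].
have /negP := neg n; have [] := step n.
rewrite -ltNge; lra.
Qed.

Lemma cvg_iter_f01 s : `|s| < 1 -> iter n (@f01 R) s @[n --> \oo] --> (1 : R).
Proof.
move=> s1; have [N sN] := iter_f01_reaches_ge0 s1.
rewrite -(cvg_shiftn N).
(* From the first nonnegative iterate on, each step halves the distance to 1. *)
rewrite (_ : (fun _ => _) =
    fun n => 1 - geometric (1 - iter N (@f01 R) s) (2^-1) n); last first.
  apply/funext => n /=; rewrite iterD exprVn -iter_f01_ge0//; lra.
have half1 : `|2^-1 : R| < 1 by rewrite ger0_norm; lra.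
have := cvgB (cvg_cst (1 : R)) (cvg_geometric (1 - iter N (@f01 R) s) half1).
by rewrite subr0; exact.
Qed.

End vertical_shift.

(** * A slowly growing, almost antiperiodic wave *)

Section wave.
Variable R : realType.
Implicit Types t : R.

Definition root4 t : R := Num.sqrt (Num.sqrt t).

Lemma root4_continuous : continuous root4.
Proof.
move=> t; apply: (@continuous_comp _ _ _ (@Num.sqrt R) (@Num.sqrt R));
  exact: sqrt_continuous.
Qed.

Lemma root4_near_ge t K : 0 <= t -> \forall n \near \oo, K <= root4 (t + n%:R).
Proof.
move=> t0; exists (Num.bound (`|K| ^+ 4)) => // n /= Kn.
apply: le_trans (ler_norm K) _.
rewrite -[leLHS]ger0_norm// -sqrtr_sqr -[X in Num.sqrt X]ger0_norm ?sqr_ge0//.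
rewrite -sqrtr_sqr -exprM /root4 !ler_wsqrtr//.
apply: (@le_trans _ _ n%:R); last by rewrite lerDr.
apply: ltW; apply: lt_le_trans (archi_boundP _) _; first exact: exprn_ge0.
by rewrite ler_nat.
Qed.

Definition wave t : R :=
  root4 t ^+ 2 * cos (pi * t) + root4 t * sin (pi * t).

Lemma wave_continuous : continuous wave.
Proof.
move=> t.
have pit : pi * x @[x --> t] --> pi * t by apply: cvgMr; exact: cvg_id.
apply: cvgD; apply: cvgM.
- by rewrite expr2; apply: cvgM; exact: root4_continuous.
- by apply: (continuous_comp pit); exact: continuous_cos.
- exact: root4_continuous.
- by apply: (continuous_comp pit); exact: continuous_sin.
Qed.

(** Passing from t to t + 1 negates cos and sin, so only the increments of a^2 and a remain, where a
    is [root4]. As a^4 grows by 1, a^2 grows by at most 1 / a^2, and a grows by no more than a^2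
    does, since a >= 1. *)
Lemma wave_almost_antiperiodic t : 1 <= t ->
  `|wave t + wave (t + 1)| <= 2 / Num.sqrt t.
Proof.
move=> t1; rewrite /wave mulrDr mulr1 cosDpi sinDpi.
set C := cos _; set S := sin _.
set a := root4 t; set a' := root4 (t + 1).
have a1 : 1 <= a.
  by rewrite -[1]sqrtr1 -[X in Num.sqrt X]sqrtr1 !ler_wsqrtr.
have aa' : a <= a' by rewrite !ler_wsqrtr//; lra.
have a2 : a ^+ 2 = Num.sqrt t by rewrite sqr_sqrtr ?sqrtr_ge0.
have a'2 : a' ^+ 2 = Num.sqrt (t + 1) by rewrite sqr_sqrtr ?sqrtr_ge0.
have a4 : (a' ^+ 2) ^+ 2 - (a ^+ 2) ^+ 2 = 1.
  by rewrite a2 a'2 !sqr_sqrtr; lra.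
have -> : a ^+ 2 * C + a * S + (a' ^+ 2 * - C + a' * - S) =
  - ((a' ^+ 2 - a ^+ 2) * C + (a' - a) * S) by ring.
have C1 : `|C| <= 1 by rewrite ler_norml cos_geN1 cos_le1.
have S1 : `|S| <= 1 by rewrite ler_norml sin_geN1 sin_le1.
rewrite normrN -a2 ler_pdivlMr ?exprn_gt0//; last lra.
apply: (@le_trans _ _ (((a' ^+ 2 - a ^+ 2) + (a' - a)) * a ^+ 2)).
  apply: ler_wpM2r; first exact: sqr_ge0.
  apply: le_trans (ler_normD _ _) _.
  rewrite !normrM (@ger0_norm _ (_ - _)); last nra.
  rewrite (@ger0_norm _ (a' - a)); last lra.
  by apply: lerD; apply: ler_piMr => //; nra.
have : a' - a <= a' ^+ 2 - a ^+ 2 by nra.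
nra.
Qed.

(** Up to the sign (-1)^n the values are a^2 C + a S with C and S independent of n. The quadratic
    term decides the sign unless C = 0, and then |S| = 1. *)
Lemma wave_alternates t : 0 <= t -> exists e : bool,
  (-1) ^+ e * ((-1) ^+ n * wave (t + n%:R)) @[n --> \oo] --> +oo.
Proof.
move=> t0.
set C := cos (pi * t); set S := sin (pi * t).
have waveE n : (-1) ^+ n * wave (t + n%:R) =
    root4 (t + n%:R) ^+ 2 * C + root4 (t + n%:R) * S.
  rewrite /wave (mulrDr pi) mulr_natr (alternatingn (@cosDpi R)).
  rewrite (alternatingn (@sinDpi R)) -/C -/S.
  by have := sqrr_sign R n; move: ((-1) ^+ n) => e e2; ring: e2.
have S1 : `|S| <= 1 by rewrite ler_norml sin_geN1 sin_le1.
have CS : C ^+ 2 + S ^+ 2 = 1 by rewrite cos2Dsin2.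
have [C0|C0] := eqVneq C 0.
  exists (S < 0); apply/cvgryPge => A.
  near=> n; rewrite waveE C0 mulr0 add0r mulrCA -normrEsign.
  have -> : `|S| = 1.
    by move: CS; rewrite C0 expr0n add0r -real_normK ?num_real// => /eqP;
       rewrite sqrp_eq1 ?normr_ge0// => /eqP.
  by rewrite mulr1; near: n; exact: root4_near_ge.
exists (C < 0); apply/cvgryPge => A.
near=> n; rewrite waveE mulrDr 2!(mulrCA ((-1) ^+ _)) -normrEsign.
have aA : `|A| <= root4 (t + n%:R) by near: n; exact: root4_near_ge.
(* With a |C| >= 2, the sum a^2 |C| + a S' with S' >= -1 is at least 2 a - a = a. *)
have aC : 2 / `|C| <= root4 (t + n%:R) by near: n; exact: root4_near_ge.
move: (root4 _) aA aC => a aA aC.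
rewrite ler_pdivrMr ?normr_gt0// in aC.
have : - 1 <= (-1) ^+ (C < 0)%R * S.
  by rewrite lerNl; apply: le_trans (ler_norm _) _; rewrite normrN normrMsign.
move: ((-1) ^+ _ * S) => S' S'1.
have := ler_norm A; have := normr_ge0 A; nra.
Unshelve. all: end_near. Qed.

End wave.

(** * The functions [b] and [G], and the continuity of [G] at the ends of J *)

Section shear.
Variable R : realType.
Implicit Types s : R.

(* The coordinate that increases by 1 along [f01] when [0 <= s < 1]. *)
Definition depth s : R := - (ln (1 - `|s|) / ln 2).

Definition bend s : R := wave (depth s).

(** This is [G], with [bend] as [b]. The value 0 is its limit at -1 and 1, so that it is continuous
    on the whole line. *)
Definition shear s : R := if `|s| < 1 then bend s + bend (f01 s) else 0.

Let ln2_gt0 : 0 < ln 2 :> R.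
Proof. by apply: ln_gt0; lra. Qed.

Lemma bendN s : bend (- s) = bend s.
Proof. by rewrite /bend /depth normrN. Qed.

(** The two summands are exchanged, [bend] being even. Hence levels s and - f01 s carry the same
    reflection x |-> G s - x, which makes the map conjugated by s |-> - s an inverse. *)
Lemma shear_f01N s : shear (- f01 s) = shear s.
Proof.
rewrite /shear normrN f01_norm_lt1; case: ifP => // _.
by rewrite bendN -(bendN (f01 (- _))) f01NK addrC.
Qed.

Lemma depth_ge0 s : `|s| < 1 -> 0 <= depth s.
Proof.
move=> s1; rewrite /depth oppr_ge0 mulr_le0_ge0 ?invr_ge0 ?(ltW ln2_gt0)//.
apply: ln_le0; have := normr_ge0 s; lra.
Qed.

Lemma depth_f01 s : 0 <= s -> s < 1 -> depth (f01 s) = depth s + 1.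
Proof.
move=> s0 s1; rewrite /depth f01_ge0// !ger0_norm//; last lra.
have -> : 1 - (s + 1) / 2 = (1 - s) / 2 by lra.
rewrite ln_div ?posrE//; last lra.
by rewrite mulrBl divff ?gt_eqF//; lra.
Qed.

Lemma depth_iter_f01 n s : 0 <= s -> s < 1 ->
  depth (iter n (@f01 R) s) = depth s + n%:R.
Proof.
move=> s0 s1.
suff [] : depth (iter n (@f01 R) s) = depth s + n%:R /\
  0 <= iter n (@f01 R) s < 1 by [].
elim: n => /= [|n [IHn /andP[sn0 sn1]]]; first by rewrite addr0 s0 s1.
split; first by rewrite depth_f01// IHn -addrA natr1.
by rewrite f01_ge0//; apply/andP; split; lra.
Qed.

Lemma bend_alternates s : `|s| < 1 -> exists e : bool,
  (-1) ^+ e * ((-1) ^+ n * bend (iter n (@f01 R) s)) @[n --> \oo] --> +oo.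
Proof.
move=> s1; have [N sN0] := iter_f01_reaches_ge0 s1.
have sN1 : iter N (@f01 R) s < 1.
  exact: le_lt_trans (ler_norm _) (iter_f01_norm_lt1 N s1).
have [e He] := wave_alternates (depth_ge0 (iter_f01_norm_lt1 N s1)).
(* The N steps spent reaching [0, 1) multiply the sign by (-1)^N. *)
exists (e (+) odd N); rewrite -(cvg_shiftn N).
apply: cvg_trans He; apply: near_eq_cvg; near=> n.
rewrite /= iterD /bend [in RHS]depth_iter_f01// signr_addb exprD signr_odd.
rewrite -!mulrA [in RHS](mulrCA ((-1) ^+ N) ((-1) ^+ n)).
by rewrite (mulrA ((-1) ^+ N)) -expr2 sqrr_sign mul1r.
Unshelve. all: end_near. Qed.

Lemma bend_continuous s : `|s| < 1 -> {for s, continuous bend}.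
Proof.
move=> s1; apply: (@continuous_comp _ _ _ depth (@wave R));
  last exact: wave_continuous.
apply: cvgN; apply: cvgMl.
apply: (@continuous_comp _ _ _ (fun s => 1 - `|s|) (@ln R)).
  by apply: cvgB; [exact: cvg_cst|exact: norm_continuous].
apply: continuous_ln; lra.
Qed.

Lemma shear_near1 (eps : R) : 0 < eps ->
  \forall s \near (1 : R), `|shear s| <= eps.
Proof.
move=> eps0; pose K := Num.max 1 ((2 / eps) ^+ 2).
pose d := Num.min 1 (expR (- (K * ln 2))).
have d0 : 0 < d by rewrite lt_min ltr01 expR_gt0.
exists d => //= s /= sd; rewrite /shear; case: ifPn => [s1|_]; last first.
  by rewrite normr0 ltW.
move: (s1); rewrite ltr_norml => /andP[sN1 s1'].
move: sd; rewrite ger0_norm ?lt_min; last lra.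
move=> /andP[s0 sK].
have {}s0 : 0 <= s by lra.
rewrite /bend depth_f01//.
have : K <= depth s.
  rewrite /depth -mulNr ler_pdivlMr// lerNr -[leRHS]expRK.
  by rewrite ler_ln ?posrE ?expR_gt0// ger0_norm//; [exact: ltW|lra].
rewrite ge_max => /andP[t1 tK].
apply: le_trans (wave_almost_antiperiodic t1) _.
rewrite ler_pdivrMr ?sqrtr_gt0; last lra.
rewrite mulrC -ler_pdivrMr// -[leLHS]ger0_norm ?divr_ge0 ?(ltW eps0)//.
by rewrite -sqrtr_sqr ler_wsqrtr.
Qed.

Lemma shear_continuous : continuous shear.
Proof.
have shear10 : shear 1 = 0 by rewrite /shear normr1 ltxx.
have shear1 : {for 1, continuous shear}.
  apply/cvgrPdist_le => eps /shear_near1; apply: filterS => s.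
  by rewrite shear10 sub0r normrN.
move=> s; have [s1|s1|s1] := ltgtP `|s| 1.
- have : (fun x => bend x + bend (f01 x)) @ s --> shear s.
    rewrite /shear s1; apply: cvgD; first exact: bend_continuous.
    apply: (@continuous_comp _ _ _ (@f01 R) bend); first exact: f01_continuous.
    by apply: bend_continuous; rewrite f01_norm_lt1.
  apply: cvg_trans; apply: near_eq_cvg; near=> x.
  rewrite /shear ifT//; near: x.
  by apply: (cvgr_lt `|s|) => //; exact: norm_continuous.
- have : cst 0 @ s --> shear s by rewrite /shear ltNge ltW//; exact: cvg_cst.
  apply: cvg_trans; apply: near_eq_cvg; near=> x.
  rewrite /shear ifF//; apply/negbTE; rewrite -leNgt ltW//; near: x.
  by apply: (cvgr_gt `|s|) => //; exact: norm_continuous.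
- move: s1; have [s0 ->//|s0 sN1] := ger0P s.
  (* Continuity at -1 follows from continuity at 1: s |-> - f01 s sends -1 to 1 and preserves
     [shear]. *)
  have -> : shear = shear \o (fun x => - f01 x).
    by apply/funext => x /=; rewrite shear_f01N.
  apply: continuous_comp; first by apply: cvgN; exact: f01_continuous.
  suff -> : - f01 s = 1 by [].
  by rewrite (_ : s = -1) ?f01_N1; lra.
Unshelve. all: end_near. Qed.

End shear.

(** * The homeomorphism *)

Section flip.
Variable R : realType.
Implicit Types w r x c : R.

(* [flip (expR c)] is [x |-> c - x] in the coordinate [r = th x]; unlike the
   latter it makes sense up to [r = -1, 1]. *)
Definition flip w r : R := (w * (1 - r) - (1 + r)) / (w * (1 - r) + (1 + r)).

Lemma flip_den_gt0 w r : 0 < w -> -1 <= r <= 1 -> 0 < w * (1 - r) + (1 + r).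
Proof. by move=> w0 /andP[r1 r2]; have [->|] := eqVneq r 1; nra. Qed.

Lemma flip_itv w r : 0 < w -> -1 <= r <= 1 -> -1 <= flip w r <= 1.
Proof.
move=> w0 r1; have d0 := flip_den_gt0 w0 r1; move: r1 => /andP[r1 r2].
by rewrite ler_pdivlMr// ler_pdivrMr//; apply/andP; split; nra.
Qed.

Lemma flipK w r : 0 < w -> -1 <= r <= 1 -> flip w (flip w r) = r.
Proof.
move=> w0 r1; have /gt_eqF/negbT d0 := flip_den_gt0 w0 r1.
by rewrite /flip; field; rewrite d0; apply/eqP => e; lra.
Qed.

Lemma flip_lt w r1 r2 : 0 < w -> -1 <= r1 -> r1 < r2 -> r2 <= 1 ->
  flip w r2 < flip w r1.
Proof.
move=> w0 r1N1 r12 r21.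
have d1 : 0 < w * (1 - r1) + (1 + r1) by apply: flip_den_gt0 => //; lra.
have d2 : 0 < w * (1 - r2) + (1 + r2) by apply: flip_den_gt0 => //; lra.
rewrite ltr_pdivrMr// mulrAC ltr_pdivlMr// -subr_gt0.
rewrite (_ : _ - _ = 4 * (w * (r2 - r1))); last ring.
by rewrite !mulr_gt0//; lra.
Qed.

Lemma flip1 w : flip w 1 = -1.
Proof. by rewrite /flip subrr mulr0 sub0r add0r mulNr divff// pnatr_eq0. Qed.

Lemma flipN1 w : 0 < w -> flip w (-1) = 1.
Proof.
rewrite /flip => w0; rewrite subrr subr0 addr0 divff//.
by rewrite gt_eqF// mulr_gt0//; lra.
Qed.

Lemma flip_1 r : flip 1 r = - r.
Proof. by rewrite /flip (_ : 1 * (1 - r) + (1 + r) = 2); lra. Qed.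

Lemma flip_continuous (w r : R) : 0 < w -> -1 <= r <= 1 ->
  {for (w, r), continuous (fun p => flip p.1 p.2)}.
Proof.
move=> w0 r1.
have cw : p.1 * (1 - p.2) @[p --> (w, r)] --> w * (1 - r).
  by apply: cvgM; [exact: cvg_fst|apply: cvgB; [exact: cvg_cst|exact: cvg_snd]].
have cr : (1 + p.2) @[p --> (w, r)] --> 1 + r.
  by apply: cvgD; [exact: cvg_cst|exact: cvg_snd].
apply: cvgM; first exact: cvgB.
by apply: cvgV; [rewrite gt_eqF// flip_den_gt0|exact: cvgD].
Qed.

(** This is tanh (x / 2), for which x |-> c - x becomes a fractional linear map with coefficient
    expR c. *)
Definition th x : R := (expR x - 1) / (expR x + 1).

Lemma th_den_gt0 x : 0 < expR x + 1.
Proof. by have := expR_gt0 x; lra. Qed.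

Lemma flip_th c x : flip (expR c) (th x) = th (c - x).
Proof.
have x0 := expR_gt0 x; have c0 := expR_gt0 c.
rewrite /flip /th expRD expRN; field.
by rewrite !gt_eqF//; nra.
Qed.

Lemma thN x : th (- x) = - th x.
Proof.
have x0 := expR_gt0 x.
by rewrite /th expRN; field; rewrite !gt_eqF//; lra.
Qed.

Lemma th_sign (e : bool) x : (-1) ^+ e * th x = th ((-1) ^+ e * x).
Proof. by case: e; rewrite ?expr0 ?expr1 ?mul1r ?mulN1r ?thN. Qed.

Lemma th_surj r : `|r| < 1 -> exists x, th x = r.
Proof.
rewrite ltr_norml => /andP[r1 r2]; exists (ln ((1 + r) / (1 - r))).
rewrite /th lnK ?posrE ?divr_gt0//; [field|lra|lra].
by rewrite !gt_eqF//; lra.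
Qed.

Lemma cvg_th : th x @[x --> +oo] --> (1 : R).
Proof.
apply/cvgrPdist_le => eps eps0; near=> x.
have -> : 1 - th x = 2 / (expR x + 1).
  by have := th_den_gt0 x => /gt_eqF/negbT; rewrite /th => ?; field.
have d0 := th_den_gt0 x.
rewrite ger0_norm ?divr_ge0 ?(ltW d0)// ler_pdivrMr// mulrC -ler_pdivrMr//.
apply: (@le_trans _ _ x); last by have := expR_ge1Dx x; lra.
by near: x; apply: nbhs_pinfty_ge; rewrite num_real.
Unshelve. all: end_near. Qed.

End flip.

(** * The map on the square *)

Section square.
Variable R : realType.
Implicit Types p : square R.

Lemma JE (r : R) : J R r <-> -1 <= r <= 1.
Proof. by rewrite /J /= in_itv. Qed.

Lemma square_eq p q :
  (\val p).1 = (\val q).1 -> (\val p).2 = (\val q).2 -> p = q.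
Proof.
move=> e1 e2; apply: val_inj; rewrite [LHS]surjective_pairing.
by rewrite e1 e2 -surjective_pairing.
Qed.

Lemma val_square_continuous : continuous (fun p => \val p).
Proof. exact: initial_continuous. Qed.

Lemma cvg_square (T : Type) (F : set_system T) (u : T -> square R) p :
  Filter F -> (\val (u x)).1 @[x --> F] --> (\val p).1 ->
  (\val (u x)).2 @[x --> F] --> (\val p).2 -> u @ F --> p.
Proof.
move=> FF u1 u2 U [? /= [[W oW <-]] /= Wp] /filterS; apply.
have : (fun x => ((\val (u x)).1, (\val (u x)).2)) @ F -->
    ((\val p).1, (\val p).2).
  exact: (@cvg_pair _ _ _ _ (nbhs (\val p).1) (nbhs (\val p).2)).
move/(_ W); rewrite -surjective_pairing /nbhs /=.
have nW : nbhs (\val p) W by exact: open_nbhs_nbhs.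
move=> /(_ nW); apply: filterS => x /=.
by rewrite -surjective_pairing.
Qed.

Lemma continuous_square (T : topologicalType) (f : T -> square R) :
  (forall x, (\val (f y)).1 @[y --> x] --> (\val (f x)).1) ->
  (forall x, (\val (f y)).2 @[y --> x] --> (\val (f x)).2) -> continuous f.
Proof.
by move=> f1 f2 x; exact: (@cvg_square T (nbhs x) f (f x) _ (f1 x) (f2 x)).
Qed.

Definition sigma p : square R := mk_square (square1P p) (J_opp (square2P p)).

Lemma sigmaK : involutive sigma.
Proof. by move=> p; apply: square_eq => //=; rewrite opprK. Qed.

Lemma cvg_square1 p : (\val q).1 @[q --> p] --> (\val p).1.
Proof.
apply: (@continuous_comp _ _ _ (fun q : square R => \val q) fst).
  exact: val_square_continuous.
exact: cvg_fst.
Qed.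

Lemma cvg_square2 p : (\val q).2 @[q --> p] --> (\val p).2.
Proof.
apply: (@continuous_comp _ _ _ (fun q : square R => \val q) snd).
  exact: val_square_continuous.
exact: cvg_snd.
Qed.

Lemma sigma_continuous : continuous sigma.
Proof.
apply: continuous_square => p /=; first exact: cvg_square1.
exact: (cvgN (@cvg_square2 p)).
Qed.

Lemma J_flip_shear p : J R (flip (expR (shear (\val p).2)) (\val p).1).
Proof.
by apply/JE/flip_itv; [exact: expR_gt0|apply/JE; exact: square1P].
Qed.

(** The map (x, s) |-> (G s - x, f01 s), read in r = th x and extended to the vertical sides by
    [flip]. *)
Definition rise p : square R :=
  mk_square (J_flip_shear p) (J_f01 (square2P p)).

Lemma riseK p : sigma (rise (sigma (rise p))) = p.
Proof.
apply: square_eq => /=; last by rewrite f01NK.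
rewrite shear_f01N flipK ?expR_gt0//.
by apply/JE; exact: square1P.
Qed.

Lemma rise_continuous : continuous rise.
Proof.
apply: continuous_square => p /=; last first.
  apply: (@continuous_comp _ _ _ (fun q : square R => (\val q).2) (@f01 R)).
    exact: cvg_square2.
  exact: f01_continuous.
have cw : expR (shear (\val q).2) @[q --> p] --> expR (shear (\val p).2).
  apply: (@continuous_comp _ _ _ (fun q : square R => shear (\val q).2)
    (@expR R)).
    apply: (@continuous_comp _ _ _ (fun q : square R => (\val q).2) (@shear R)).
      exact: cvg_square2.
    exact: shear_continuous.
  exact: continuous_expR.
apply: (@continuous_comp _ _ _ (fun q : square R =>
  (expR (shear (\val q).2), (\val q).1)) (fun x => flip x.1 x.2)).
  exact: (@cvg_pair _ _ _ (nbhs p) (nbhs (expR (shear (\val p).2)))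
    (nbhs (\val p).1) _ _ _ _ _ cw (@cvg_square1 p)).
by apply: flip_continuous; [exact: expR_gt0|apply/JE; exact: square1P].
Qed.

Lemma sink_continuous : continuous (sigma \o rise \o sigma).
Proof.
move=> p; apply: continuous_comp; first exact: sigma_continuous.
by apply: continuous_comp; [exact: rise_continuous|exact: sigma_continuous].
Qed.

Lemma sinkK : cancel (sigma \o rise \o sigma) rise.
Proof. by move=> p; apply: (can_inj sigmaK); exact: riseK. Qed.

Definition rise_homeo : homeomorphism (square R) (square R) :=
  @Homeomorphism _ _ rise (sigma \o rise \o sigma)
    riseK sinkK rise_continuous sink_continuous.

Lemma rise_inj : injective rise.
Proof. exact: can_inj (homeo_funK rise_homeo). Qed.

Lemma rise_normally_rising : normally_rising rise_homeo.
Proof.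
move=> s sJ; apply/seteqP; split => _ [p [/= p1 ps] <-].
  exists (mk_square (J_flip_shear p) sJ).
    by split => //; exact: J_flip_shear.
  by apply: square_eq => //=; rewrite ps.
(* [flip] is an involution, so the preimage also has the flipped first coordinate. *)
exists (mk_square (J_flip_shear p) sJ).
  by split => //; exact: J_flip_shear.
apply: square_eq => //=; last by rewrite ps.
by rewrite ps flipK ?expR_gt0//; exact/JE.
Qed.

(** Each [flip] of positive parameter exchanges -1 and 1; at the top and bottom [shear] vanishes,
    and [flip 1] is negation. *)
Lemma rise_boundary :
  {in boundary_square R, rise_homeo =1 @Psi R \o @f02 R}.
Proof.
move=> p /set_mem [[[] /= p1 _]|[_ [] /= p2]]; apply: square_eq => //=.
- by rewrite p1 flipN1 ?opprK// expR_gt0.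
- by rewrite p1 flip1.
- by rewrite p2 /shear normrN normr1 ltxx expR0 flip_1.
- by rewrite p2 /shear normr1 ltxx expR0 flip_1.
Qed.

(** * Orbits and limit sets *)

Lemma iter_sink n p :
  iter n (homeo_sym rise_homeo) p = sigma (iter n rise (sigma p)).
Proof. by elim: n => /= [|n ->]; rewrite /= ?sigmaK. Qed.

Lemma iter_rise2 n p : (\val (iter n rise p)).2 = iter n (@f01 R) (\val p).2.
Proof. by elim: n => //= n ->. Qed.

(** Measured from [bend], the coordinate only changes sign at each step: b s + b (f01 s) - (b s + x)
    = b (f01 s) - x. *)
Lemma iter_rise1 p x : `|(\val p).2| < 1 ->
  (\val p).1 = th (bend (\val p).2 + x) -> forall n,
  (\val (iter n rise p)).1 =
    th (bend (iter n (@f01 R) (\val p).2) + (-1) ^+ n * x).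
Proof.
move=> p2 px; elim=> [|n IHn]; first by rewrite mul1r.
rewrite iterS /= IHn iter_rise2 /shear iter_f01_norm_lt1// flip_th exprS.
by congr th; ring.
Qed.

Lemma rise_alternates p : interior_square R p -> exists e : bool,
  (-1) ^+ e * ((-1) ^+ n * (\val (iter n rise p)).1) @[n --> \oo] --> (1 : R).
Proof.
move=> [] /=; rewrite !in_itv /= -!ltr_norml => p1 p2.
have [x px] := th_surj p1.
have [e He] := bend_alternates p2.
exists e.
(* [th] is odd, so the signs move inside it; there they cancel on the alternating offset, leaving
   the constant [q] beside the divergent [u]. *)
pose u n := (-1) ^+ e * ((-1) ^+ n * bend (iter n (@f01 R) (\val p).2)).
pose q := (-1) ^+ e * (x - bend (\val p).2).
have -> : (fun n => (-1) ^+ e * ((-1) ^+ n * (\val (iter n rise p)).1)) =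
    fun n => th (u n + q).
  apply/funext => n.
  rewrite (@iter_rise1 _ (x - bend (\val p).2))//; last first.
    by rewrite addrCA subrr addr0.
  rewrite -[(-1) ^+ n]signr_odd !th_sign signr_odd /u /q.
  by congr th; have := sqrr_sign R n; move: ((-1) ^+ n) => d d2; ring: d2.
apply: cvg_comp (@cvg_th R).
apply/cvgryPge => A; near=> n; rewrite -lerBlDr; near: n.
by move/cvgryPge: He; apply.
Unshelve. all: end_near. Qed.

Lemma cvg_rise2 p : interior_square R p ->
  (\val (iter n rise p)).2 @[n --> \oo] --> (1 : R).
Proof.
move=> [] /=; rewrite !in_itv /= -!ltr_norml => _ p2.
rewrite (_ : (fun _ => _) = fun n => iter n (@f01 R) (\val p).2).
  exact: cvg_iter_f01.
by apply/funext => n; exact: iter_rise2.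
Qed.

(** Squaring removes the alternating sign, so limit points have first coordinate -1 or 1; each value
    is reached along the indices of one parity. *)
Lemma omega_limit_alternates (g : homeomorphism (square R) (square R)) p
    (c : R) (cJ : J R c) (e : bool) :
  (-1) ^+ e * ((-1) ^+ n * (\val (iter n g p)).1) @[n --> \oo] --> (1 : R) ->
  (\val (iter n g p)).2 @[n --> \oo] --> c ->
  omega_limit g p = [set mk_square (J_m1 R) cJ; mk_square (J_1 R) cJ].
Proof.
move=> cvg1 cvg2; apply/seteqP; split => [y [n [_ n_lt cvgy]]|].
  have n_oo : n i @[i --> \oo] --> \oo.
    apply/cvgnyPge => N; exists N => // i /= Ni; apply: leq_trans Ni _.
    by elim: i => // i IHi; exact: leq_ltn_trans (n_lt i).
  have y2 : (\val y).2 = c.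
    have yy := cvg_comp _ _ cvgy (cvg_square2 (p := y)).
    have yc := cvg_comp _ _ n_oo cvg2.
    exact: (cvg_unique (@norm_hausdorff _ R^o) yy yc).
  have y1 : (\val y).1 * (\val y).1 = 1.
    have /(cvg_comp _ _ n_oo) sqr1 :
        (\val (iter n g p)).1 * (\val (iter n g p)).1 @[n --> \oo] --> (1 : R).
      rewrite -(mulr1 1); apply: cvg_trans (cvgM cvg1 cvg1).
      apply: near_eq_cvg; near=> k; rewrite /= -!expr2 !exprMn.
      by rewrite !sqrr_sign !mul1r.
    have yy : (\val (iter (n i) g p)).1 @[i --> \oo] --> (\val y).1.
      exact: (cvg_comp _ _ cvgy (cvg_square1 (p := y))).
    exact: (cvg_unique (@norm_hausdorff _ R^o)
      (cvgM yy yy : _ @ \oo --> _) sqr1).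
  by move/eqP: y1; rewrite -expr2 sqrf_eq1 => /orP[] /eqP y1;
    [right|left]; apply: square_eq.
have sub (b : bool) (a : R) (aJ : J R a) : a = (-1) ^+ b ->
    omega_limit g p (mk_square aJ cJ).
  (* These indices have the parity of b + e, which gives the sign (-1)^b; the summand 1 makes them
     positive. *)
  move=> ab; exists (fun i => (i.*2 + 1 + (~~ b (+) e))%N); split.
  - by move=> i; rewrite addn1.
  - by move=> i; rewrite doubleS !addSn ltnS leqnSn.
  have n_oo : (i.*2 + 1 + (~~ b (+) e))%N @[i --> \oo] --> \oo.
    apply/cvgnyPge => N; exists N => // i /= Ni; rewrite -addnn -!addnA.
    exact: leq_trans Ni (leq_addr _ _).
  apply: cvg_square => /=; last exact: (cvg_comp _ _ n_oo cvg2).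
  have /(cvgM (cvg_cst a)) := cvg_comp _ _ n_oo cvg1; rewrite mulr1.
  apply: cvg_trans; apply: near_eq_cvg; near=> i => /=.
  rewrite ab !exprD -[(-1) ^+ i.*2]signr_odd odd_double.
  by case: (b) (e) => -[] /=; rewrite ?expr0 ?expr1; ring.
move=> y [] ->; [apply: (sub true)|apply: (sub false)] => //.
Unshelve. all: end_near. Qed.

Lemma omega_limit_rise p : interior_square R p ->
  omega_limit rise_homeo p = [set v1 R; v2 R].
Proof.
move=> pI; have [e He] := rise_alternates pI.
exact: (@omega_limit_alternates rise_homeo p 1 (J_1 R) e He (cvg_rise2 pI)).
Qed.

(** The backward orbit of p is the [sigma]-image of the forward orbit of [sigma p]: the first
    coordinate alternates as before, and the second tends to -1. *)
Lemma alpha_limit_rise p : interior_square R p ->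
  alpha_limit rise_homeo p = [set v3 R; v4 R].
Proof.
move=> pI; have sI : interior_square R (sigma p).
  case: pI => /=; rewrite !in_itv /= => p1 /andP[? ?].
  by split => //=; rewrite in_itv /=; apply/andP; split; lra.
have [e He] := rise_alternates sI.
apply: (@omega_limit_alternates (homeo_sym rise_homeo) p (-1) (J_m1 R) e).
- by apply: cvg_trans He; apply: near_eq_cvg; near=> n; rewrite iter_sink.
- apply: cvg_trans (cvgN (cvg_rise2 sI)).
  by apply: near_eq_cvg; near=> n; rewrite iter_sink.
Unshelve. all: end_near. Qed.

End square.

(** * Orientation *)

Section winding.
Variable R : realType.
Implicit Types x y t : R.

Definition radius x y : R := Num.sqrt (x ^+ 2 + y ^+ 2).

Lemma radius_sqr x y : radius x y ^+ 2 = x ^+ 2 + y ^+ 2.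
Proof. by rewrite sqr_sqrtr// addr_ge0 ?sqr_ge0. Qed.

Lemma radius_gt0 x y : x != 0 \/ y != 0 -> 0 < radius x y.
Proof.
rewrite sqrtr_gt0 => -[x0|y0].
- by rewrite ltr_wpDr ?sqr_ge0// exprn_even_gt0.
- by rewrite ltr_wpDl ?sqr_ge0// exprn_even_gt0.
Qed.

(* The polar angle of [(x, `|y|)], in [0, pi]; half-angle formula, rotated by
   a quarter turn so that it has no singularity on the half-plane. *)
Definition angle x y : R := pi / 2 - 2 * atan (x / (radius x y + `|y|)).

Section polar.
Variables x y : R.
Hypothesis xy0 : x != 0 \/ y != 0.

Let den_gt0 : 0 < radius x y + `|y|.
Proof. by rewrite ltr_wpDr// radius_gt0. Qed.

Let a := atan (x / (radius x y + `|y|)).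

(** From cos^2 = 1 / (1 + tan^2) and x^2 = (r - |y|)(r + |y|), with r the radius. *)
Let cos_a : cos a ^+ 2 = (radius x y + `|y|) / (2 * radius x y).
Proof.
have ca : cos a != 0.
  by rewrite gt_eqF// cos_gt0_pihalf// atan_gtNpi2 atan_ltpi2.
have := cos2_tan2 ca; rewrite atanK => ta.
rewrite -[LHS]invrK ta.
have r0 := radius_gt0 xy0.
have x2 : x ^+ 2 = radius x y ^+ 2 - `|y| ^+ 2.
  by rewrite radius_sqr real_normK ?num_real// addrK.
have d0 := den_gt0.
rewrite expr_div_n x2; field.
rewrite !gt_eqF//=; nra.
Qed.

Let sin_a : sin a = x / (radius x y + `|y|) * cos a.
Proof.
have ca : cos a != 0.
  by rewrite gt_eqF// cos_gt0_pihalf// atan_gtNpi2 atan_ltpi2.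
by rewrite -[x / _]atanK /tan -/a mulfVK.
Qed.

Lemma cos_angle : radius x y * cos (angle x y) = x.
Proof.
rewrite /angle -/a mulr_natl cosB cos_pihalf sin_pihalf mul0r mul1r add0r.
rewrite sin_mulr2n sin_a.
have -> : (cos a * (x / (radius x y + `|y|) * cos a)) *+ 2 =
  (x / (radius x y + `|y|)) * cos a ^+ 2 * 2 by rewrite -mulr_natr; ring.
rewrite cos_a; have := radius_gt0 xy0; have := den_gt0 => d0 r0.
by field; rewrite !gt_eqF.
Qed.

Lemma sin_angle : radius x y * sin (angle x y) = `|y|.
Proof.
rewrite /angle -/a mulr_natl sinB cos_pihalf sin_pihalf mul0r mul1r subr0.
rewrite cos_mulr2n cos_a; have := radius_gt0 xy0; have := den_gt0 => d0 r0.
by rewrite -mulr_natr; field; rewrite !gt_eqF.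
Qed.

End polar.

Lemma angle_pos x : 0 < x -> angle x 0 = 0.
Proof.
move=> x0; rewrite /angle /radius expr0n addr0 sqrtr_sqr normr0 addr0.
by rewrite gtr0_norm// divff ?gt_eqF// atan1; lra.
Qed.

Lemma angle_neg x : x < 0 -> angle x 0 = pi.
Proof.
move=> x0; rewrite /angle /radius expr0n addr0 sqrtr_sqr normr0 addr0.
by rewrite ltr0_norm// invrN mulrN divff ?lt_eqF// atanN atan1; lra.
Qed.

(** The loop runs from the negative axis through the upper half-plane to the positive axis, then
    back through the lower one: its angle goes from pi through 0 to - pi. *)
Lemma winding_clockwise (x y : R -> R) (c : R * R) :
  continuous x -> continuous y -> (forall t, x t != 0 \/ y t != 0) ->
  (forall t, 0 <= t <= 1 / 2 -> 0 <= y t) ->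
  (forall t, 1 / 2 <= t <= 1 -> y t <= 0) ->
  x 0 < 0 -> y 0 = 0 -> 0 < x (1 / 2) -> x 1 < 0 -> y 1 = 0 ->
  has_winding_number (fun t => (c.1 + x t, c.2 + y t)) c (-1).
Proof.
move=> xC yC xy0 y_ge0 y_le0 x0 y0 xh x1 y1.
have yh : y (1 / 2) = 0.
  by apply/le_anti/andP; split; [apply: y_le0|apply: y_ge0];
    apply/andP; split; lra.
pose k t := angle (x t) (y t).
have kh : k (1 / 2) = 0 by rewrite /k yh angle_pos.
have rC : continuous (fun t => radius (x t) (y t)).
  move=> t; apply: (@continuous_comp _ _ _ (fun t => x t ^+ 2 + y t ^+ 2)
    (@Num.sqrt R)); last exact: sqrt_continuous.
  by apply: cvgD; rewrite expr2; apply: cvgM; (exact: xC || exact: yC).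
have kC : continuous k.
  move=> t; apply: cvgB; first exact: cvg_cst.
  apply: cvgMr; apply: (@continuous_comp _ _ _
    (fun t => x t / (radius (x t) (y t) + `|y t|)) (@atan R)); last first.
    exact: continuous_atan.
  apply: cvgM; first exact: xC.
  apply: cvgV; first by rewrite gt_eqF// ltr_wpDr// radius_gt0.
  apply: cvgD; first exact: rC.
  by apply: (@continuous_comp _ _ _ y (fun t => `|t|));
    [exact: yC|exact: norm_continuous].
exists (fun t => radius (x t) (y t)).
(* Since [k (1 / 2) = 0], this is [k] on [0, 1/2] and [- k] on [1/2, 1]. *)
exists (fun t => k (Num.min t (1 / 2)) - k (Num.max t (1 / 2))); split.
- apply: continuous_subspaceT => t; apply: cvgB.
  + apply: (@continuous_comp _ _ _ (fun t => Num.min t (1 / 2)) k);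
      last exact: kC.
    by apply: continuous_min; [exact: cvg_id|exact: cvg_cst].
  + apply: (@continuous_comp _ _ _ (fun t => Num.max t (1 / 2)) k);
      last exact: kC.
    by apply: continuous_max; [exact: cvg_id|exact: cvg_cst].
- move=> t; rewrite in_itv /= => /andP[t0 t1]; split; first exact: radius_gt0.
  have [th|/ltW th] := leP t (1 / 2).
    rewrite kh subr0 /k cos_angle// sin_angle// ger0_norm//.
    by apply: y_ge0; rewrite t0.
  rewrite kh sub0r cosN sinN mulrN /k cos_angle// sin_angle//.
  rewrite ler0_norm ?opprK//.
  by apply: y_le0; rewrite th.
- rewrite (min_l (_ : 0 <= 1 / 2)) ?(max_r (_ : 0 <= 1 / 2)); [|lra..].
  rewrite (min_r (_ : 1 / 2 <= 1)) ?(max_l (_ : 1 / 2 <= 1)); [|lra..].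
  by rewrite kh /k y0 y1 !angle_neg//; lra.
Qed.

(** [f01] is increasing, so the upper half of a circle stays above the image of the center; [flip]
    is decreasing, so the ends of the horizontal diameter swap sides. The image loop thus runs
    clockwise. *)
Lemma rise_orientation_reversing : orientation_reversing (rise_homeo R).
Proof.
move=> c r gam r0 gamE.
have gam1 t : (\val (gam t)).1 = (\val c).1 + r * cos (2 * pi * t).
  by rewrite gamE.
have gam2 t : (\val (gam t)).2 = (\val c).2 + r * sin (2 * pi * t).
  by rewrite gamE.
have piC t : 2 * pi * s @[s --> t] --> 2 * pi * t.
  by apply: cvgMr; exact: cvg_id.
have gamC : continuous gam.
  apply: continuous_square => t.
  - rewrite gam1; under eq_fun do rewrite gam1.
    apply: cvgD; first exact: cvg_cst.
    by apply: cvgMr; apply: (continuous_comp (piC t)); exact: continuous_cos.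
  - rewrite gam2; under eq_fun do rewrite gam2.
    apply: cvgD; first exact: cvg_cst.
    by apply: cvgMr; apply: (continuous_comp (piC t)); exact: continuous_sin.
have riseC : continuous (fun t => rise (gam t)).
  by move=> t; apply: continuous_comp; [exact: gamC|exact: rise_continuous].
pose x t := (\val (rise (gam t))).1 - (\val (rise c)).1.
pose y t := (\val (rise (gam t))).2 - (\val (rise c)).2.
have -> : (fun t => \val (rise_homeo R (gam t))) =
    fun t => ((\val (rise c)).1 + x t, (\val (rise c)).2 + y t).
  by apply/funext => t; rewrite /x /y !subrKC -surjective_pairing.
have c2 : sin (2 * pi) = 0 :> R by rewrite mulr_natl sin2pi.
have c3 : cos (2 * pi) = 1 :> R by rewrite mulr_natl cos2pi.
have pih : 2 * pi * (1 / 2) = pi :> R by lra.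
(* Circle points on the level of c undergo the same [flip] as c, so monotonicity in r compares their
   images. *)
have horizontal t : sin (2 * pi * t) = 0 ->
    (\val (rise (gam t))).1 = flip (expR (shear (\val c).2)) (\val (gam t)).1.
  by move=> s0; rewrite /= gam2 s0 mulr0 addr0.
have cI : -1 <= (\val c).1 <= 1 by apply/JE; exact: square1P.
have gI t : -1 <= (\val (gam t)).1 <= 1 by apply/JE; exact: square1P.
apply: winding_clockwise.
- move=> t; apply: cvgB; last exact: cvg_cst.
  by apply: (@continuous_comp _ _ _ (fun t => rise (gam t))
    (fun q : square R => (\val q).1));
    [exact: riseC|exact: cvg_square1].
- move=> t; apply: cvgB; last exact: cvg_cst.
  by apply: (@continuous_comp _ _ _ (fun t => rise (gam t))
    (fun q : square R => (\val q).2));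
    [exact: riseC|exact: cvg_square2].
- move=> t; apply/orP; rewrite -negb_and; apply/negP => /andP[/eqP xt /eqP yt].
  have /rise_inj gc : rise (gam t) = rise c.
    by apply: square_eq; apply/subr0_eq.
  have := gam1 t; have := gam2 t; rewrite gc.
  have := cos2Dsin2 (2 * pi * t); nra.
- move=> t /andP[t0 th]; rewrite /y subr_ge0 /= f01_le// gam2 lerDl.
  rewrite mulr_ge0 ?(ltW r0)// sin_ge0_pi//.
  by have := pi_gt0 R => p0; apply/andP; split; nra.
- move=> t /andP[th t1]; rewrite /y subr_le0 /= f01_le// gam2 gerDl.
  rewrite pmulr_rle0// -[2 * pi * t](subrK pi) sinDpi oppr_le0 sin_ge0_pi//.
  by have := pi_gt0 R => p0; apply/andP; split; nra.
- rewrite /x subr_lt0 horizontal; last by rewrite mulr0 sin0.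
  have := gI 0; rewrite gam1 mulr0 cos0 mulr1 => /andP[? ?].
  by apply: flip_lt; rewrite ?expR_gt0//; lra.
- by rewrite /y /= gam2 mulr0 sin0 mulr0 addr0 subrr.
- rewrite /x subr_gt0 horizontal; last by rewrite pih sinpi.
  have := gI (1 / 2); rewrite gam1 pih cospi mulrN1 => /andP[? ?].
  by apply: flip_lt; rewrite ?expR_gt0//; lra.
- rewrite /x subr_lt0 horizontal; last by rewrite mulr1.
  have := gI 1; rewrite gam1 !mulr1 c3 mulr1 => /andP[? ?].
  by apply: flip_lt; rewrite ?expR_gt0//; lra.
- by rewrite /y /= gam2 mulr1 c2 mulr0 addr0 subrr.
Qed.

End winding.

Theorem lemma3p1 (R : realType) :
  exists f : homeomorphism (square R) (square R),
    [/\ normally_rising f,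
        orientation_reversing f,
        forall x : square R, interior_square R x ->
          omega_limit f x = [set v1 R; v2 R] /\
          alpha_limit f x = [set v3 R; v4 R] &
        {in boundary_square R, f =1 @Psi R \o @f02 R}].
Proof.
exists (rise_homeo R); split.
- exact: rise_normally_rising.
- exact: rise_orientation_reversing.
- by move=> p pI; split; [exact: omega_limit_rise|exact: alpha_limit_rise].
- exact: rise_boundary.
Qed.
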